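(* Let $k\ge 2$ be an integer, let $0<\alpha<1$, $1<p<\frac1\alpha$ and $\frac1q=\frac1p-\alpha$. Set $\delta=\frac{1-\alpha p-\alpha p^2}{1-\alpha p}$. Let $w$ be a weight on the infinite rooted $k$-ary tree $\mathcal{T}^k$ for which there is a constant $C_0>0$ such that for all $r\in\mathbb{N}_0$, all $i,j\in\mathbb{N}_0$ with $|i-j|\le r$, and all $x\in\mathcal{T}_j$, $$w(\mathcal{T}_i\cap S(x,r))\le C_0\,k^{\frac{r+i-j}{2}(p-\delta)}\,k^{r\delta}\,w(x)^{q/p}.$$ Then $w\in\mathcal{Z}_{p,q}^{\epsilon,\alpha}$ with $\epsilon=\frac{1-p\alpha}{1-\alpha}$.
   Context: $\mathcal{T}^k$ is the infinite rooted $k$-ary tree: the infinite rooted tree in which every vertex has exactly $k$ children (successors). It is identified with its set of vertices. $\mathcal{T}_0$ is the set consisting of the root, and for $i\ge1$, $\mathcal{T}_i$ is the set of children of the vertices in $\mathcal{T}_{i-1}$, so $\mathcal{T}^k=\bigcup_{i\ge0}\mathcal{T}_i$. $d(x,y)$ is the number of edges of the unique minimal path joining $x$ and $y$. $\mathbb{N}=\{1,2,\dots\}$ and $\mathbb{N}_0=\mathbb{N}\cup\{0\}$. For $x\in\mathcal{T}^k$ and $r\in\mathbb{N}_0$, $S(x,r)=\{y\in\mathcal{T}^k: d(x,y)=r\}$. A weight is a non-negative function $w$ on $\mathcal{T}^k$, and $w(A)=\sum_{x\in A}w(x)$ for $A\subset\mathcal{T}^k$. For $1<p,q<\infty$, $0<\alpha<1$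 and $\epsilon\in(0,1)$, a weight $w$ belongs to $\mathcal{Z}_{p,q}^{\epsilon,\alpha}$ if there is a constant $C>0$ such that for all $r\in\mathbb{N}$ and all sets $E,F\subset\mathcal{T}^k$, $$\sum_{x\in E}w(F\cap S(x,r))\le C\,k^{\epsilon r(1-\alpha)}\,w(E)^{1/p}\,w(F)^{1-1/q}.$$ *)

(* Defs.v *)
From HB Require Import structures.
From mathcomp Require Import all_boot all_order all_algebra.
From mathcomp Require Import all_classical all_reals all_analysis.
Set Implicit Arguments.
Unset Strict Implicit.
Unset Printing Implicit Defensive.
Import Order.TTheory GRing.Theory Num.Theory.
Local Open Scope classical_set_scope.
Local Open Scope ring_scope.

(* A vertex is the word of child labels read from the vertex up to the root:
   the root is [::] and the k children of x are the words a :: x. *)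
Definition tree (k : nat) : choiceType := seq 'I_k.

Definition root_vertex (k : nat) : tree k := [::].

Definition is_child (k : nat) (x y : tree k) : bool :=
  [exists a : 'I_k, y == a :: x].

Definition adj (k : nat) : rel (tree k) :=
  fun x y => is_child x y || is_child y x.

Fixpoint level {k : nat} (i : nat) : set (tree k) :=
  match i with
  | 0 => [set root_vertex k]
  | i'.+1 => [set y | exists2 x, level i' x & is_child x y]
  end.

Definition joined_by_path (k : nat) (x y : tree k) (n : nat) : Prop :=
  exists p : seq (tree k), [/\ path (@adj k) x p, last x p = y & size p = n].

Lemma tree_connected (k : nat) (x y : tree k) :
  exists n, `[< joined_by_path x y n >].
Proof.
have up (z : tree k) : exists p, path (@adj k) z p /\ last z p = root_vertex k.
  elim: z => [|a z [p [zp lp]]]; first by exists [::].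
  exists (z :: p); split => //=; rewrite zp andbT /adj.
  by apply/orP; right; apply/existsP; exists a.
have down (z : tree k) :
    exists p, path (@adj k) (root_vertex k) p /\ last (root_vertex k) p = z.
  elim: z => [|a z [p [zp lp]]]; first by exists [::].
  exists (rcons p (a :: z)); rewrite rcons_path last_rcons zp lp; split => //=.
  by rewrite /adj; apply/orP; left; apply/existsP; exists a.
have [p [xp lp]] := up x; have [q [yq lq]] := down y.
exists (size (p ++ q)); apply/asboolP; exists (p ++ q).
by rewrite cat_path last_cat lp xp yq lq.
Qed.

Definition dist (k : nat) (x y : tree k) : nat := ex_minn (tree_connected x y).

Definition sphere (k : nat) (x : tree k) (r : nat) : set (tree k) :=
  [set y | dist x y = r].

Section weights.
Context {R : realType} {k : nat}.
Implicit Type w : tree k -> R.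

Definition is_weight w : Prop := forall x, 0 <= w x.

Definition mass w (A : set (tree k)) : \bar R :=
  (\esum_(x in A) (w x)%:E)%R.

(* E and F may be infinite, so both sides live in [0, +oo], with the usual
   convention 0 * +oo = 0. *)
Definition in_Z (p q eps alpha : R) w : Prop :=
  exists C : R, 0 < C /\
    forall (r : nat) (E F : set (tree k)), (0 < r)%N ->
      (\esum_(x in E) mass w (F `&` sphere x r) <=
       (C * k%:R `^ (eps * r%:R * (1 - alpha)))%:E
         * mass w E `^ p^-1 * mass w F `^ (1 - q^-1))%E.

End weights.

(* Main.v *)
Require Import Defs.
From HB Require Import structures.
From mathcomp Require Import all_boot all_order all_algebra.
From mathcomp Require Import all_classical all_reals all_analysis.
From mathcomp Require Import finmap zify ring lra.
Import Order.TTheory GRing.Theory Num.Theory.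
Local Open Scope classical_set_scope.
Local Open Scope ring_scope.

(** Put K = k and 1/q' = 1 - 1/q. The relations between the parameters amount to
    delta = 1 + p - q, p - delta = q - 1 and
    epsilon * (1 - alpha) = 1 - p * alpha = p / q.

    A path from x to a vertex y of S(x, r) makes m steps down and r - m steps up
    for some m <= r; this determines the level of y. Let I_m be the contribution
    to the left side of the pairs (x, y) that belong to a given m. It has two
    bounds.
    - Summing over x first: a vertex y has at most K^(r - m) partners x
      ([size_up_down_le]), so I_m <= K^(r - m) * w(F)
      ([esum_mass_up_down_le]).
    - Summing over y first: the condition on w gives
      I_m <= C0 * K^(m * (q - 1)) * K^(r * delta) * sum_(x in E) w(x)^(q/p), and
      the last sum is at most w(E)^(q/p) because q >= p ([esum_powR_le]).

    With X = C0 * K^(r * delta) * w(E)^(q/p) and Y = K^r * w(F) these read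
    I_m <= min(X * K^(m * (q - 1)), Y * K^(-m)). One bound grows geometrically
    with m and the other decays geometrically, so that the sum over m is
    comparable to the value where they cross, which is X^(1/q) * Y^(1/q')
    ([sum_min_geometric_le]). The exponent of K in this product is
    r * (delta / q + 1 - 1/q) = r * p / q, those of w(E) and w(F) are 1/p and
    1/q', as required. *)

(** * Sums of minima of two geometric progressions *)

(** The terms not exceeding Z are an initial segment of a growing geometric
    progression, so their sum is dominated by the last of them. *)
Lemma sum_geometric_le (R : realFieldType) (s X Z : R) (n : nat) :
  1 < s -> 0 < X -> 0 <= Z ->
  \sum_(m < n | X * s ^+ m <= Z) X * s ^+ m <= Z * (s / (s - 1)).
Proof.
move=> s1 X0 Z0.
have s10 : 0 < s - 1 by rewrite subr_gt0.
have c0 : 0 <= s / (s - 1) by rewrite divr_ge0 ?ltW// (lt_trans ltr01).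
elim: n => [|n IH]; first by rewrite big_ord0 mulr_ge0.
have [uZ|Zu] := leP (X * s ^+ n) Z; last first.
  by rewrite big_mkcond big_ord_recr /= (lt_geF Zu) addr0 -big_mkcond.
apply: (@le_trans _ _ (X * s ^+ n * (s / (s - 1)))); last exact: ler_wpM2r.
apply: (@le_trans _ _ (\sum_(m < n.+1) X * s ^+ m)).
  rewrite big_mkcond; apply: ler_sum => m _; case: ifP => // _.
  by rewrite mulr_ge0 ?exprn_ge0// ?ltW// (lt_trans ltr01).
rewrite -mulr_sumr -mulrA ler_pM2l// mulrA -exprSr ler_pdivlMr// mulrC -subrX1.
by rewrite gerBl.
Qed.

(** Reversing the order of summation turns the decreasing progression into a
    growing one. *)
Lemma sum_geometricV_le (R : realFieldType) (t Y Z : R) (n : nat) :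
  1 < t -> 0 < Y -> 0 <= Z ->
  \sum_(m < n | Y * t ^- m <= Z) Y * t ^- m <= Z * (t / (t - 1)).
Proof.
case: n => [|n] t1 Y0 Z0.
  by rewrite big_ord0 mulr_ge0// divr_ge0 ?subr_ge0 ?ltW// (lt_trans ltr01).
have t0 : 0 < t by rewrite (lt_trans ltr01).
rewrite (reindex_inj rev_ord_inj) /=.
have E (i : 'I_n.+1) : Y * t ^- (n.+1 - i.+1) = Y * t ^- n * t ^+ i.
  have ti : t ^+ i != 0 by rewrite gt_eqF ?exprn_gt0.
  have tn : t ^+ n = t ^+ (n - i) * t ^+ i by rewrite -exprD subnK// -ltnS.
  by rewrite subSS tn invfM mulrA mulfVK.
under eq_bigl do rewrite E; under eq_bigr do rewrite E.
by apply: sum_geometric_le => //; rewrite mulr_gt0// invr_gt0 exprn_gt0.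
Qed.

Lemma powRD_gt0 (R : realType) (x r s : R) : 0 < x ->
  x `^ (r + s) = x `^ r * x `^ s.
Proof. by move=> x0; rewrite powRD// (gt_eqF x0) implybT. Qed.

Lemma min_le_geometric_mean (R : realType) (u v t : R) :
  0 < u -> 0 < v -> 0 <= t <= 1 -> Num.min u v <= u `^ t * v `^ (1 - t).
Proof.
move=> u0 v0 /andP[t0 t1]; have m0 : 0 < Num.min u v by rewrite lt_min u0.
have {1}-> : Num.min u v = Num.min u v `^ t * Num.min u v `^ (1 - t).
  by rewrite -powRD_gt0// addrCA subrr addr0 powRr1// ltW.
by apply: ler_pM; rewrite ?powR_ge0// ge0_ler_powR ?nnegrE ?subr_ge0//
  ?(ltW u0) ?(ltW v0) ?(ltW m0)// ge_min lexx ?orbT.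
Qed.

(** The weights in the geometric mean Z on the right are the ones for which
    replacing (X, Y) by (X * K ^ (q - 1), Y / K) leaves Z unchanged. So Z is the
    same geometric mean of the two entries of each minimum, whence each minimum
    is one of the entries that do not exceed Z; the entries of either sequence
    that do not exceed Z form part of a geometric progression, whose sum is
    comparable to its largest term. This makes C independent of n, where
    summing the bound Z for each minimum would lose a factor n. *)
Lemma sum_min_geometric_le (R : realType) (K q : R) : 1 < K -> 1 < q ->
  exists2 C : R, 0 < C & forall X Y n, 0 < X -> 0 < Y ->
    \sum_(m < n) Num.min (X * (K `^ (q - 1)) ^+ m) (Y * K ^- m) <=
    C * (X `^ q^-1 * Y `^ (1 - q^-1)).
Proof.
move=> K1 q1; set s := K `^ (q - 1).
have K0 : 0 < K by rewrite (lt_trans ltr01).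
have q0 : 0 < q by rewrite (lt_trans ltr01).
have s1 : 1 < s.
  by rewrite -(powRr0 K) /s /powR gt_eqF// ltr_expR mul0r mulr_gt0 ?ln_gt0 ?subr_gt0.
have s0 : 0 < s by rewrite (lt_trans ltr01).
exists (s / (s - 1) + K / (K - 1)).
  by rewrite addr_gt0// divr_gt0// subr_gt0.
move=> X Y n X0 Y0; set Z := _ * Y `^ _.
have Z0 : 0 <= Z by rewrite mulr_ge0 ?powR_ge0.
have ZE m : (X * s ^+ m) `^ q^-1 * (Y * K ^- m) `^ (1 - q^-1) = Z.
  rewrite !powRM ?invr_ge0 ?exprn_ge0 ?ltW// /s.
  rewrite -[_ ^+ m]powR_mulrn ?powR_ge0// -powR_invn ?(ltW K0)// -!powRrM.
  rewrite mulrACA -powRD_gt0//.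
  suff -> : (q - 1) * (m%:R * q^-1) + - m%:R * (1 - q^-1) = 0.
    by rewrite powRr0 mulr1.
  by field; rewrite gt_eqF.
rewrite mulrC mulrDr.
apply: le_trans (lerD (sum_geometric_le R s X Z n s1 X0 Z0)
  (sum_geometricV_le R K Y Z n K1 Y0 Z0)).
rewrite (big_mkcond (fun i : 'I_n => X * _ <= Z)).
rewrite (big_mkcond (fun i : 'I_n => Y * _ <= Z)) -big_split /=.
apply: ler_sum => m _.
have u0 : 0 < X * s ^+ m by rewrite mulr_gt0 ?exprn_gt0.
have v0 : 0 < Y * K ^- m by rewrite mulr_gt0 ?invr_gt0 ?exprn_gt0.
have qV01 : 0 <= q^-1 <= 1 by rewrite invr_ge0 invf_le1// !ltW.
have := min_le_geometric_mean _ _ _ _ u0 v0 qV01; rewrite ZE.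
have [_ uZ|_ vZ] := leP (X * s ^+ m) (Y * K ^- m).
  by rewrite uZ lerDl; case: ifP => // _; exact: ltW.
by rewrite vZ lerDr; case: ifP => // _; exact: ltW.
Qed.

(** * Distances in the tree *)

Lemma level_size (k i : nat) (y : tree k) : level i y <-> size y = i.
Proof.
elim: i y => [|i IH] y /=; first by split=> [->|/size0nil].
split=> [[x /IH <- /existsP[a /eqP ->]]//|].
case: y => [//|a y] /= [/IH iy]; exists y => //.
by apply/existsP; exists a.
Qed.

(** A step to a child adds one descent and a step to the parent one ascent. The
    path need not be a geodesic and l may exceed the depth of x, since
    drop saturates at the root; only the numbers of both kinds of steps matter. *)
Lemma path_up_down (k : nat) (x : tree k) (s : seq (tree k)) :
  path (@adj k) x s -> exists l m, [/\ (l + m)%N = size s,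
    (size (last x s) + l = size x + m)%N & drop l x = drop m (last x s)].
Proof.
elim: s x => [|x' s IH] x /=; first by exists 0%N, 0%N.
case/andP => /orP[] /existsP[a /eqP E] /IH [l [m [lm sz dr]]]; move: sz dr.
  rewrite E /= => sz dr; exists l, m.+1.
  split; [by rewrite addnS lm|by rewrite sz addSn addnS|].
  by rewrite -addn1 addnC -drop_drop -dr drop_drop add1n.
move=> sz dr; exists l.+1, m; rewrite E /=.
by split => //; [rewrite addSn lm|rewrite addnS sz].
Qed.

(** The vertices at which a path from x with l ascents and m descents can end.
    The equation on sizes fixes the level of y also when the climbs are cut short by
    the root. *)
Definition up_down (k l m : nat) (x : tree k) : set (tree k) :=
  [set y | (size y + l = size x + m)%N /\ drop l x = drop m y].

Lemma sphere_up_down (k r : nat) (x y : tree k) : sphere x r y ->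
  exists m : 'I_r.+1, up_down k (r - m) m x y.
Proof.
rewrite /sphere /= /dist; case: ex_minnP => n /asboolP[s [xs <- sn]] _ nr.
have [l [m [lm sz dr]]] := path_up_down k x s xs.
have mr : (m < r.+1)%N by lia.
by exists (Ordinal mr); rewrite /= (_ : r - m = l)%N//; lia.
Qed.

(** All such x have the same length and the same end drop m y, so x is
    determined by its first l letters (by all its letters when x is shorter
    than l). *)
Lemma size_up_down_le (k l m : nat) (y : tree k) (s : seq (tree k)) :
  (0 < k)%N -> uniq s -> {in s, forall x, up_down k l m x y} -> (size s <= k ^ l)%N.
Proof.
move=> k0; case: s => [//|x0 s'] us xs; set s := x0 :: s' in us xs *.
set n := minn l (size x0).
have szE x : x \in s -> size x = size x0.
  by move=> /xs[h _]; have [h0 _] := xs x0 (mem_head _ _); lia.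
apply: (@leq_trans (size [seq val t ++ drop m y | t <- enum {: n.-tuple 'I_k}])).
  apply: uniq_leq_size => // x xins; have [_ dx] := xs x xins.
  have sx : size (take l x) == n by rewrite size_take_min szE.
  apply/mapP; exists (Tuple sx); first by rewrite mem_enum.
  by rewrite /= -dx cat_take_drop.
rewrite size_map -cardE card_tuple card_ord.
by rewrite leq_pexp2l// geq_minl.
Qed.

(** * Sums over arbitrary sets *)

Lemma exchange_esum (R : realType) (T1 T2 : choiceType) (A : set T1)
    (B : set T2) (r : T1 -> T2 -> Prop) (f : T1 -> T2 -> \bar R) :
  (forall x y, (0 <= f x y)%E) ->
  (\esum_(x in A) \esum_(y in B `&` [set y | r x y]) f x y =
   \esum_(y in B) \esum_(x in A `&` [set x | r x y]) f x y)%E.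
Proof.
move=> f0; rewrite !esum_esum//.
apply: (@reindex_esum _ _ _ _ _ (fun z : T2 * T1 => (z.2, z.1))).
split => [[y x] [? [? ?]]|[y x] [y' x'] _ _ [-> ->]|[x y] [? [? ?]]] //.
by exists (y, x).
Qed.

Lemma esumZl_le (R : realType) (T : choiceType) (A : set T) (c : R)
    (f : T -> \bar R) : 0 <= c -> (forall x, (0 <= f x)%E) ->
  (\esum_(x in A) (c%:E * f x) <= c%:E * \esum_(x in A) f x)%E.
Proof.
move=> c0 f0; apply: ge_ereal_sup => _ [X XA <-].
rewrite -ge0_mule_fsumr//.
rewrite lee_wpmul2l ?lee_fin//; apply: ereal_sup_ubound; by exists X.
Qed.

(** Since s >= 1 and no w x exceeds the total a, each term obeys
    w x ^ s <= a ^ (s - 1) * w x. *)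
Lemma esum_powR_le (R : realType) (T : choiceType) (A : set T) (w : T -> R)
    (a s : R) : (forall x, 0 <= w x) -> 1 <= s ->
  \esum_(x in A) (w x)%:E = a%:E ->
  (\esum_(x in A) (w x `^ s)%:E <= (a `^ s)%:E)%E.
Proof.
move=> w0 s1 wa.
have s0 : 0 < s by rewrite (lt_le_trans ltr01).
have a0 : 0 <= a by rewrite -lee_fin -wa esum_ge0// => x _; rewrite lee_fin.
have wxa x : A x -> w x <= a.
  move=> Ax; rewrite -lee_fin -wa; apply: esum_ge; exists [set x].
    by split=> [|_ ->//]; exact: finite_set1.
  by rewrite fsbig_set1.
rewrite -(mulr_powRB1 a0 s0) mulrC EFinM -[X in (_ * X)%E]wa.
have wE0 x : (0 <= (w x)%:E)%E by rewrite lee_fin.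
apply: le_trans (esumZl_le R T A _ _ (powR_ge0 a (s - 1)) wE0).
apply: le_esum => x Ax; rewrite -EFinM lee_fin -(mulr_powRB1 (w0 x) s0) mulrC.
rewrite ler_wpM2r// ge0_ler_powR ?nnegrE// ?subr_ge0//; exact: wxa.
Qed.

Lemma esum_const_le (R : realType) (T : choiceType) (A : set T) (c : R)
    (n : nat) : 0 <= c ->
  (forall s : seq T, uniq s -> {in s, forall x, A x} -> (size s <= n)%N) ->
  (\esum_(x in A) c%:E <= (n%:R * c)%:E)%E.
Proof.
move=> c0 An; apply: ge_ereal_sup => _ [X [fX XA] <-].
rewrite fsbig_finite//= sumEFin lee_fin big_const_seq count_predT iter_addr_0.
rewrite -[leLHS]mulr_natl ler_wpM2r// ler_nat; apply: An => [|x].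
  exact: fset_uniq.
by rewrite in_fset_set// => /set_mem/XA.
Qed.

(** * Masses of pieces of spheres *)

Lemma mass_ge0 (R : realType) (k : nat) (w : tree k -> R)
    (A : set (tree k)) : is_weight w -> (0 <= mass w A)%E.
Proof. by move=> w0; apply: esum_ge0 => x _; rewrite lee_fin. Qed.

Lemma le_mass (R : realType) (k : nat) (w : tree k -> R)
    (A B : set (tree k)) : is_weight w -> A `<=` B -> (mass w A <= mass w B)%E.
Proof.
move=> w0 AB; rewrite /mass esum_mkcond [leRHS]esum_mkcond; apply: le_esum => x _.
case: ifPn => [/set_mem/AB/mem_set ->//|_]; case: ifP => // _.
by rewrite lee_fin.
Qed.

Lemma mass_sphere_le (R : realType) (k : nat) (w : tree k -> R)
    (F : set (tree k)) (x : tree k) (r : nat) : is_weight w ->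
  (mass w (F `&` sphere x r) <=
   \sum_(m < r.+1)
     mass w (F `&` (sphere x r `&` up_down k (r - m) m x)))%E.
Proof.
move=> w0; rewrite /mass; under eq_bigr do rewrite esum_mkcond.
rewrite esum_mkcond -esum_sum; last first.
  by move=> y m _ _; case: ifP => // _; rewrite lee_fin.
apply: le_esum => y _.
have ge0 (m : 'I_r.+1) : true ->
    (0 <= if y \in F `&` (sphere x r `&` up_down k (r - m) m x)
          then (w y)%:E else 0)%E.
  by case: ifP => // _; rewrite lee_fin.
case: ifPn => [/set_mem[Fy yr]|_]; last exact: sume_ge0.
have [m xym] := sphere_up_down k r x y yr.
rewrite (bigD1 m)//= ifT; last exact/mem_set.
by rewrite leeDl// sume_ge0// => i _; apply: ge0.
Qed.

(** Double counting: each y in F is reached from at most k ^ l vertices x. *)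
Lemma esum_mass_up_down_le (R : realType) (k : nat) (w : tree k -> R)
    (E F : set (tree k)) (l m : nat) : is_weight w -> (0 < k)%N ->
  (\esum_(x in E) mass w (F `&` up_down k l m x) <=
    (k%:R ^+ l)%:E * mass w F)%E.
Proof.
move=> w0 k0; rewrite /mass exchange_esum; last by move=> _ y; rewrite lee_fin.
have wE0 x : (0 <= (w x)%:E)%E by rewrite lee_fin.
have kl0 : 0 <= k%:R ^+ l :> R by rewrite exprn_ge0.
apply: le_trans (esumZl_le R _ F _ _ kl0 wE0).
apply: le_esum => y _; rewrite -EFinM -natrX.
apply: esum_const_le => // s us sE.
by apply: (size_up_down_le k l m y) => // x /sE[].
Qed.

(** * The weighted inequality *)

Theorem theorem1p4 (R : realType) (k : nat) (alpha p q delta : R)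
    (w : tree k -> R)
    (hk : (2 <= k)%N)
    (halpha : 0 < alpha < 1)
    (hp : 1 < p < alpha^-1)
    (hq : q^-1 = p^-1 - alpha)
    (hdelta : delta = (1 - alpha * p - alpha * p ^+ 2) / (1 - alpha * p))
    (hw : is_weight w)
    (hC0 : exists C0 : R, 0 < C0 /\
       forall (r i j : nat) (x : tree k),
         `|i%:R - j%:R| <= r%:R :> R -> level j x ->
         (mass w (level i `&` sphere x r) <=
          (C0 * k%:R `^ ((r%:R + i%:R - j%:R) / 2 * (p - delta))
              * k%:R `^ (r%:R * delta) * w x `^ (q / p))%:E)%E) :
  in_Z p q ((1 - p * alpha) / (1 - alpha)) alpha w.
Proof.
have [C0 [C00 hC]] := hC0; have /andP[alpha0 alpha1] := halpha.
have /andP[p1 pa] := hp.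
have p0 : 0 < p by rewrite (lt_trans ltr01).
have beta0 : 0 < 1 - alpha * p.
  by rewrite subr_gt0 mulrC -ltr_pdivlMr// div1r.
have qE : q = p / (1 - alpha * p).
  by rewrite -[LHS]invrK hq; field; rewrite !gt_eqF//=.
have p_lt_q : p < q.
  by rewrite qE ltr_pdivlMr// gtr_pMr// ltrBlDr ltrDl mulr_gt0.
have q1 : 1 < q by rewrite (lt_trans p1).
have q0 : 0 < q by rewrite (lt_trans p0).
have deltaE : delta = 1 + p - q.
  by rewrite hdelta qE; field; rewrite gt_eqF.
have K1 : 1 < k%:R :> R by rewrite ltr1n.
have K0 : 0 < k%:R :> R by rewrite (lt_trans ltr01).
have k0 : (0 < k)%N by rewrite (leq_trans _ hk).
have [C Cgt0 hsum] := sum_min_geometric_le R k%:R q K1 q1.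
exists (C * C0 `^ q^-1); split; first by rewrite mulr_gt0// powR_gt0.
move=> r E F _.
set s := k%:R `^ (q - 1) in hsum.
(* The part of the sphere reached by m descents lies in the single level i, with
   r + i - size x = 2 m, where the condition on w applies. *)
have hxm x (m : 'I_r.+1) :
    (mass w (F `&` (sphere x r `&` up_down k (r - m) m x)) <=
     ((C0 * k%:R `^ (r%:R * delta) * s ^+ m) * w x `^ (q / p))%:E)%E.
  have mr : (m <= r)%N by rewrite -ltnS.
  have [up|up] := leqP (r - m) (size x + m); last first.
    rewrite (_ : _ `&` _ = set0); last first.
      apply/seteqP; split => // y [_ [_ [h _]]]; move: up.
      by rewrite -h ltnNge leq_addl.
    by rewrite /mass esum_set0 lee_fin !mulr_ge0 ?exprn_ge0 ?powR_ge0// ltW.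
  set i := (size x + m - (r - m))%N.
  have iE : i%:R + r%:R = (size x)%:R + m%:R + m%:R :> R.
    by rewrite -!natrD -{1}(subnK mr) addnA subnK.
  have mrR : m%:R <= r%:R :> R by rewrite ler_nat.
  have m0 : 0 <= m%:R :> R by [].
  apply: (@le_trans _ _ (mass w (level i `&` sphere x r))).
    apply: le_mass => // y [_ [yr [h _]]]; split=> //; apply/level_size.
    by rewrite /i -h addnK.
  apply: le_trans (hC r i (size x) x _ _) _; last 1 first.
  - rewrite lee_fin -[in leRHS]powR_mulrn ?powR_ge0// /s -powRrM.
    rewrite (_ : _ / 2 * _ = (q - 1) * m%:R); first by rewrite [C0 * _ * _]mulrAC.
    have -> : i%:R = (size x)%:R + m%:R + m%:R - r%:R :> R by rewrite -iE addrK.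
    by rewrite deltaE; field.
  - by rewrite ler_norml; apply/andP; split; lra.
  - exact/level_size.
pose I (m : 'I_r.+1) := (\esum_(x in E)
  mass w (F `&` (sphere x r `&` up_down k (r - m) m x)))%E.
have leI : (\esum_(x in E) mass w (F `&` sphere x r) <= \sum_(m < r.+1) I m)%E.
  rewrite -esum_sum; last by move=> *; exact: mass_ge0.
  by apply: le_esum => x _; exact: mass_sphere_le.
apply: le_trans leI _.
have I_count m : (I m <= (k%:R ^+ (r - m))%:E * mass w F)%E.
  apply: le_trans (esum_mass_up_down_le R k w E F (r - m) m hw k0).
  by apply: le_esum => x _; apply: le_mass => // y [Fy [_ h]].
have I_hyp m a : mass w E = a%:E ->
    (I m <= (C0 * k%:R `^ (r%:R * delta) * a `^ (q / p) * s ^+ m)%:E)%E.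
  move=> aE; pose c := C0 * k%:R `^ (r%:R * delta) * s ^+ m.
  have c0 : 0 <= c by rewrite !mulr_ge0 ?exprn_ge0 ?powR_ge0// ltW.
  have wq0 x : (0 <= (w x `^ (q / p))%:E)%E by rewrite lee_fin powR_ge0.
  apply: le_trans (le_esum (fun x _ => hxm x m)) _.
  apply: le_trans (esumZl_le R _ E _ _ c0 wq0) _.
  rewrite [in leRHS]mulrAC -/c [leRHS]EFinM lee_wpmul2l ?lee_fin//.
  by apply: esum_powR_le => //; rewrite ler_pdivlMr// mul1r ltW.
have a0 : (0 <= mass w E)%E := mass_ge0 R k w E hw.
have b0 : (0 <= mass w F)%E := mass_ge0 R k w F hw.
set cst := C * _ * _.
have cst0 : 0 < cst by rewrite !mulr_gt0 ?powR_gt0.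
have rhs0 : (0 <= cst%:E * mass w E `^ p^-1 * mass w F `^ (1 - q^-1))%E.
  by rewrite !mule_ge0 ?poweR_ge0// lee_fin ltW.
have pV0 : 0 < p^-1 by rewrite invr_gt0.
have qV0 : 0 < 1 - q^-1 by rewrite subr_gt0 invf_lt1.
(* A mass 0 must annihilate the left side too, because 0 * +oo = 0 on the right. *)
have [bE|bN0] := eqVneq (mass w F) 0%E.
  apply: le_trans rhs0; apply: sume_le0 => m _.
  by rewrite (le_trans (I_count m))// bE mule0.
have [aE|aN0] := eqVneq (mass w E) 0%E.
  apply: le_trans rhs0; apply: sume_le0 => m _.
  rewrite (le_trans (I_hyp m 0 aE))// powR0 ?mulr0 ?mul0r//.
  by rewrite gt_eqF ?divr_gt0.
have {}a0 : (0 < mass w E)%E by rewrite lt_neqAle eq_sym aN0.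
have {}b0 : (0 < mass w F)%E by rewrite lt_neqAle eq_sym bN0.
have [aoo|] := eqVneq (mass w E) +oo%E.
  by rewrite aoo poweRyr ?gt_eqF// gt0_muley ?lte_fin// gt0_mulye ?poweR_gt0// leey.
have [boo _|] := eqVneq (mass w F) +oo%E.
  rewrite boo poweRyr ?gt_eqF// gt0_muley ?leey//.
  by rewrite mule_gt0 ?lte_fin ?poweR_gt0.
move: a0 b0 I_count I_hyp; case: (mass w E) => // a; case: (mass w F) => // b.
rewrite !lte_fin => a0 b0 I_count I_hyp _ _.
set X := C0 * k%:R `^ (r%:R * delta) * a `^ (q / p) in I_hyp.
have X0 : 0 < X by rewrite !mulr_gt0 ?powR_gt0.
have Y0 : 0 < k%:R ^+ r * b by rewrite mulr_gt0 ?exprn_gt0.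
apply: (@le_trans _ _ (\sum_(m < r.+1)
    (Num.min (X * s ^+ m) (k%:R ^+ r * b * k%:R ^- m))%:E)%E).
  apply: lee_sum => m _; rewrite EFin_min le_min (I_hyp m a erefl) /=.
  rewrite (le_trans (I_count m))// -EFinM lee_fin.
  have Km : k%:R ^+ m != 0 :> R by rewrite gt_eqF ?exprn_gt0.
  have -> : k%:R ^+ r = k%:R ^+ (r - m) * k%:R ^+ m :> R.
    by rewrite -exprD subnK// -ltnS.
  by rewrite mulrAC mulfK.
rewrite sumEFin !poweR_EFin -!EFinM lee_fin.
apply: le_trans (hsum X (k%:R ^+ r * b) r.+1 X0 Y0) _.
rewrite /X !powRM ?mulr_ge0 ?powR_ge0 ?exprn_ge0 ?(ltW K0) ?(ltW C00) ?(ltW b0)//.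
rewrite -powR_mulrn ?(ltW K0)// -!powRrM /cst.
rewrite (_ : q / p * q^-1 = p^-1); last by field; rewrite !gt_eqF.
rewrite (_ : _ * r%:R * (1 - alpha) =
    r%:R * delta * q^-1 + r%:R * (1 - q^-1)); last first.
  by rewrite deltaE qE; field; rewrite (gt_eqF beta0) (gt_eqF p0) subr_eq0 gt_eqF.
rewrite (powRD_gt0 R _ _ _ K0) le_eqVlt; apply/orP; left; apply/eqP; ring.
Qed.
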